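(* Let $q$ be a prime power and let $L$ be a line of $\mathrm{PG}(5,q)$ in the $K$-orbit $o_{10}$. Then the hyperplane-orbit distribution of $L$ is $OD_4(L)=[1,\,q^2+q,\,q^2,\,q^3-q^2]$.
   Context: A point $(y_0,\dots,y_5)$ of $\mathrm{PG}(5,q)$ is identified with the nonzero symmetric matrix $\begin{bmatrix} y_0&y_1&y_2\\ y_1&y_3&y_4\\ y_2&y_4&y_5\end{bmatrix}$ up to scalar. $K\cong\mathrm{PGL}(3,q)$ acts by $M\mapsto AMA^T$, $A\in\mathrm{GL}(3,q)$. The orbit $o_{10}$ is the $K$-orbit of the line $\left\{\begin{bmatrix} v_0x&y&0\\ y&x+uy&0\\ 0&0&0\end{bmatrix}:(x,y)\in\mathrm{PG}(1,q)\right\}$, where $u,v_0\in\mathbb F_q$, $v_0\ne0$, satisfy $v_0\lambda^2+uv_0\lambda-1\neq0$ for all $\lambda\in\mathbb F_q$ (the orbit does not depend on the choice of such $u,v_0$). Hyperplanes correspond to conics of $\mathrm{PG}(2,q)$ (nonzero quadratic forms up to scalar): $\sum_{0\le i\le j\le2}a_{ij}X_iX_j$ corresponds to $a_{00}Y_0+a_{01}Y_1+a_{02}Y_2+a_{11}Y_3+a_{12}Y_4+a_{22}Y_5=0$. $\mathcal H_1,\mathcal H_{2,r},\mathcal H_{2,i},\mathcal H_3$ are the sets of hyperplanes corresponding respectively to double lines (scalar multiples of squares of linear forms), pairs of distinct real lines (products of two non-proportional linear forms over $\mathbb F_q$), pairs of conjugate imaginary lines (scalar multiples of products of two non-proportional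 linear forms conjugate over $\mathbb F_{q^2}$), and non-singular conics (those with $4a_{00}a_{11}a_{22}+a_{01}a_{02}a_{12}-a_{00}a_{12}^2-a_{11}a_{02}^2-a_{22}a_{01}^2\ne0$). $OD_4(L)=[h_1,h_{2,r},h_{2,i},h_3]$ lists the numbers of hyperplanes in $\mathcal H_1,\mathcal H_{2,r},\mathcal H_{2,i},\mathcal H_3$ containing $L$. *)

(* Defs.v *)
From HB Require Import structures.
From mathcomp Require Import all_boot all_order all_fingroup all_algebra all_solvable all_field.
From mathcomp.multinomials Require Import mpoly.

Set Implicit Arguments.
Unset Strict Implicit.
Unset Printing Implicit Defensive.

Import GRing.Theory.
Local Open Scope ring_scope.

Section ProjectiveSpace.

Variable F : finFieldType.

(* A point of PG(5,q) is the class, up to nonzero scalars, of a nonzero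
   symmetric 3 x 3 matrix; it is represented by the finite set of all the
   matrices in this class. Lines and hyperplanes are sets of points. *)
Notation pointT := {set 'M[F]_3}.

Definition pg_point (M : 'M[F]_3) : pointT := [set c *: M | c : F & c != 0].

Definition PG5 : {set pointT} :=
  [set pg_point M | M : 'M[F]_3 & (M^T == M) && (M != 0)].

Definition pg_join (M N : 'M[F]_3) : {set pointT} :=
  [set pg_point (z.1 *: M + z.2 *: N) | z : F * F & z != (0, 0)].

Definition pg_lines : {set {set pointT}} :=
  [set pg_join z.1 z.2 | z : 'M[F]_3 * 'M[F]_3 &
     [&& z.1^T == z.1, z.2^T == z.2 & free [:: z.1; z.2]]].

Definition K_act (A : 'M[F]_3) (P : pointT) : pointT :=
  [set A *m M *m A^T | M in P].

Definition K_orbit (L : {set pointT}) : {set {set pointT}} :=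
  [set K_act A @: L | A : 'M[F]_3 & A \in unitmx].

Definition sym_mx (y0 y1 y2 y3 y4 y5 : F) : 'M[F]_3 :=
  \matrix_(i, j)
    nth 0 (nth [::] [:: [:: y0; y1; y2]; [:: y1; y3; y4]; [:: y2; y4; y5]] i) j.

Definition o10_line (u v0 : F) : {set pointT} :=
  [set pg_point (sym_mx (v0 * z.1) z.2 0 (z.1 + u * z.2) 0 0)
     | z : F * F & z != (0, 0)].

Definition o10_param (u v0 : F) : bool :=
  (v0 != 0) && [forall l : F, v0 * l ^+ 2 + u * v0 * l - 1 != 0].

(* All admissible (u, v0) give the same K-orbit, so that this union of orbits
   is a single orbit. *)
Definition o10 : {set {set pointT}} :=
  [set L | [exists u : F, exists v0 : F,
              o10_param u v0 && (L \in K_orbit (o10_line u v0))]].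

End ProjectiveSpace.

Section Forms.

Variable R : comNzRingType.

Definition lform (l : 'rV[R]_3) : {mpoly R[3]} := \sum_(i < 3) l 0 i *: 'X_i.

(* Only the coefficients a i j with i <= j are used, here and below; the
   entries of a below the diagonal are irrelevant. *)
Definition qform (a : 'M[R]_3) : {mpoly R[3]} :=
  \sum_(i < 3) \sum_(j < 3 | (i <= j)%N) a i j *: ('X_i * 'X_j).

End Forms.

Section Hyperplanes.

Variable F : finFieldType.
Implicit Type a : 'M[F]_3.

Definition double_line a : bool :=
  [exists c : F, exists l : 'rV[F]_3,
     [&& c != 0, l != 0 & qform a == c *: lform l ^+ 2]].

Definition real_line_pair a : bool :=
  [exists l : 'rV[F]_3, exists m : 'rV[F]_3,
     free [:: l; m] && (qform a == lform l * lform m)].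

(* E is the field with q^2 elements, with F embedded in it by iota; its
   nontrivial automorphism over F is x |-> x ^+ q. Such a pair (E, iota) exists
   by quadratic_extension_exists below. *)
Definition imag_line_pair (E : finFieldType) (iota : {rmorphism F -> E}) a
    : bool :=
  [exists c : F, exists l : 'rV[E]_3,
     let l' := map_mx (fun x => x ^+ #|F|) l in
     [&& c != 0, free [:: l; l'] &
         map_mpoly iota (qform a) == iota c *: (lform l * lform l')]].

Definition nonsingular_conic a : bool :=
  let a00 := a 0 0 in let a01 := a 0 1 in let a02 := a 0 2%:R in
  let a11 := a 1 1 in let a12 := a 1 2%:R in let a22 := a 2%:R 2%:R in
  4%:R * a00 * a11 * a22 + a01 * a02 * a12
    - a00 * a12 ^+ 2 - a11 * a02 ^+ 2 - a22 * a01 ^+ 2 != 0.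

Definition hyperplane a : {set {set 'M[F]_3}} :=
  [set P in PG5 F |
     [forall M in P, \sum_(i < 3) \sum_(j < 3 | (i <= j)%N) a i j * M i j == 0]].

Definition hyperplanes_of (C : pred 'M[F]_3) : {set {set {set 'M[F]_3}}} :=
  [set hyperplane a | a : 'M[F]_3 & C a].

Definition num_hyperplanes (C : pred 'M[F]_3) (L : {set {set 'M[F]_3}}) : nat :=
  #|[set H in hyperplanes_of C | L \subset H]|.

Definition OD4 (E : finFieldType) (iota : {rmorphism F -> E})
    (L : {set {set 'M[F]_3}}) : seq nat :=
  [:: num_hyperplanes double_line L;
      num_hyperplanes real_line_pair L;
      num_hyperplanes (imag_line_pair iota) L;
      num_hyperplanes nonsingular_conic L].

End Hyperplanes.

Lemma quadratic_extension_exists (F : finFieldType) :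
  exists (E : finFieldType) (iota : {rmorphism F -> E}), #|E| = (#|F| ^ 2)%N.
Proof.
set m := (#|F| ^ 2)%N.
have F_gt1 := finNzRing_gt1 F.
have m_gt1: (m > 1)%N by rewrite (leq_trans F_gt1) // leq_pmulr // ltnW.
have m_gt0 := ltnW m_gt1; have m1_gt0: (m.-1 > 0)%N by rewrite -ltnS prednK.
pose q (R : nzRingType) : {poly R} := 'X ^+ m - 'X.
have Dq (R : nzRingType) : q R = ('X ^+ m.-1 - 1) * ('X - 0).
  by rewrite subr0 mulrBl mul1r -exprSr prednK.
have /FinSplittingFieldFor[/= L splitLq]: q F != 0.
  rewrite Dq monic_neq0 // rpredM ?monicXnsubC //.
  by rewrite -[0]/(0%:P) monicXsubC.
rewrite [map_poly _ _]rmorphB rmorphXn /= map_polyX -/(q L) in splitLq.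
have m0 : m%:R = 0 :> L.
  have F0 : #|F|%:R = 0 :> F.
    by rewrite -FinRing.zmodXgE -cardsT; apply: expg_cardG; rewrite inE.
  have <-: in_alg L (m%:R : F) = m%:R by rewrite rmorph_nat.
  by rewrite /m natrX F0 expr0n rmorph0.
pose E := FinFieldExtType L.
exists E, (in_alg L).
have /finField_galois_generator[/= a _ Da]: (1 <= {:L})%VS by apply: sub1v.
pose Em := fixedSpace (a ^+ 2)%g; rewrite dimv1 expn1 in Da.
have{splitLq} [zs DqL defL] := splitLq.
have Uzs: uniq zs.
  rewrite -separable_prod_XsubC -(eqp_separable DqL) Dq separable_root andbC.
  rewrite /root !hornerE subr_eq0 eq_sym expr0n gtn_eqF ?oner_eq0 //=.
  rewrite cyclotomic.separable_Xn_sub_1 // -subn1 natrB // subr_eq0.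
  by rewrite m0 eq_sym oner_eq0.
suffices /eq_card->: E =i zs.
  apply: succn_inj; rewrite (card_uniqP _) //= -(size_prod_XsubC _ id).
  by rewrite -(eqp_size DqL) size_polyDl size_polyXn // size_polyN size_polyX.
have in_zs: zs =i Em.
  move=> z; rewrite -root_prod_XsubC -(eqp_root DqL) (sameP fixedSpaceP eqP).
  rewrite /root !hornerE subr_eq0 /= /m; congr (_ == z).
  by rewrite expgS expg1 galM ?memvf // !Da ?memvf // -exprM mulnn.
suffices defEm: Em = {:L}%VS by move=> z; rewrite in_zs defEm memvf.
apply/eqP; rewrite eqEsubv subvf -defL -[Em]subfield_closed agenvS //.
by rewrite subv_add sub1v; apply/span_subvP=> z; rewrite in_zs.
Qed.

(* Main.v *)
(* Every class of hyperplanes is stable under linear substitutions, so it is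
   enough to treat the representative line of parameters (u, v0). The conics
   whose hyperplanes contain it are
     al (X0^2 + u v0 X0 X1 - v0 X1^2) + X2 (b X0 + c X1 + d X2),
   where the binary quadratic form has no zero over F. If al = 0 the conic is a
   double line when b = c = 0, and a pair of distinct real lines otherwise. If
   al = 1 it has no F-rational point on X2 = 0, hence no linear factor over F;
   its discriminant is affine in d with slope -(t - t^q)^2, where t in E is a root
   of X^2 - u v0 X - v0, so exactly one d for each (b, c) gives a singular conic,
   which then splits over E. No case distinction on the characteristic occurs. *)

Require Import Defs.
From HB Require Import structures.
From mathcomp Require Import all_boot all_order all_fingroup all_algebra all_solvable all_field.
From mathcomp.multinomials Require Import mpoly.
From mathcomp Require Import ring.

Set Implicit Arguments.
Unset Strict Implicit.
Unset Printing Implicit Defensive.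

Import GRing.Theory.
Local Open Scope ring_scope.

Local Notation o0 := (0 : 'I_3).
Local Notation o1 := (1 : 'I_3).
Local Notation o2 := (2%:R : 'I_3).

(** * Case analysis and explicit sums over three indices *)

Lemma forall_ord3 (P : 'I_3 -> Prop) : P o0 -> P o1 -> P o2 -> forall i, P i.
Proof.
move=> P0 P1 P2 [[|[|[|k]]] // lt_i3].
- by rewrite (_ : Ordinal lt_i3 = o0) //; apply: val_inj.
- by rewrite (_ : Ordinal lt_i3 = o1) //; apply: val_inj.
- by rewrite (_ : Ordinal lt_i3 = o2) //; apply: val_inj.
Qed.

Lemma big_ord3 (V : nmodType) (f : 'I_3 -> V) : \sum_i f i = f o0 + f o1 + f o2.
Proof.
rewrite !big_ord_recl big_ord0 addr0 addrA.
by congr (f _ + f _ + f _); apply: val_inj.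
Qed.

Lemma big_upper3 (V : nmodType) (f : 'I_3 -> 'I_3 -> V) :
  \sum_(i < 3) \sum_(j < 3 | (i <= j)%N) f i j
    = f o0 o0 + f o0 o1 + f o0 o2 + f o1 o1 + f o1 o2 + f o2 o2.
Proof.
rewrite big_ord3 !(big_mkcond (fun j : 'I_3 => (_ <= j)%N)) !big_ord3 /=.
by rewrite !add0r !addrA.
Qed.

(** * Ternary quadratic forms in coordinates: substitution, factorization, discriminant *)

Section Forms.

Variable R : comNzRingType.
Implicit Types (a b B M : 'M[R]_3) (l m : 'rV[R]_3).

Definition pairing a M := \sum_(i < 3) \sum_(j < 3 | (i <= j)%N) a i j * M i j.

(* The upper-triangular coefficients of the form x |-> Q_a(x B), for row
   vectors x; the other entries are irrelevant. *)
Definition subst B a : 'M[R]_3 :=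
  \matrix_(i, j) \sum_(k < 3) \sum_(n < 3 | (k <= n)%N)
     a k n * (B i k * B j n + (B j k * B i n) *+ (i != j)).

(** The coefficientwise version of [qform a = c *: (lform l * lform m)]. Off the diagonal two
    products contribute to the coefficient of a monomial, on it only one, so nothing is divided by
    2. *)
Definition factors a (c : R) l m : Prop :=
  forall i j : 'I_3, (i <= j)%N ->
    a i j = c * (l 0 i * m 0 j + (l 0 j * m 0 i) *+ (i != j)).

Definition disc a :=
  4%:R * a o0 o0 * a o1 o1 * a o2 o2 + a o0 o1 * a o0 o2 * a o1 o2
    - a o0 o0 * a o1 o2 ^+ 2 - a o1 o1 * a o0 o2 ^+ 2 - a o2 o2 * a o0 o1 ^+ 2.

(** Substitution in forms is adjoint to congruence of symmetric matrices. Symmetry of [M] matters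
    because [pairing] reads only the upper triangle. *)
Lemma pairing_subst B a M :
  M^T = M -> pairing (subst B a) M = pairing a (B^T *m M *m B).
Proof.
move=> /matrixP symM.
rewrite /pairing !big_upper3 !mxE !big_upper3 !big_ord3 !mxE !big_ord3 !mxE /=.
have := symM o0 o1; have := symM o0 o2; have := symM o1 o2.
rewrite !mxE => -> -> ->; ring.
Qed.

Lemma factorsP a c l m : factors a c l m <->
  ((a o0 o0 = c * (l 0 o0 * m 0 o0) /\
    a o1 o1 = c * (l 0 o1 * m 0 o1) /\
    a o2 o2 = c * (l 0 o2 * m 0 o2)) /\
   (a o0 o1 = c * (l 0 o0 * m 0 o1 + l 0 o1 * m 0 o0) /\
    a o0 o2 = c * (l 0 o0 * m 0 o2 + l 0 o2 * m 0 o0) /\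
    a o1 o2 = c * (l 0 o1 * m 0 o2 + l 0 o2 * m 0 o1))).
Proof.
split=> [fact_a | [[e00 [e11 e22]] [e01 [e02 e12]]]].
  by rewrite !fact_a //= !addr0.
by elim/forall_ord3=> [||]; elim/forall_ord3=> //= _; rewrite addr0.
Qed.

Lemma factors_subst B a c l m :
  factors a c l m -> factors (subst B a) c (l *m B^T) (m *m B^T).
Proof.
move=> /factorsP[[e00 [e11 e22]] [e01 [e02 e12]]]; apply/factorsP.
rewrite !mxE !big_upper3 !big_ord3 !mxE /=.
rewrite e00 e11 e22 e01 e02 e12.
by do !split; ring.
Qed.

Lemma disc_factors a c l m : factors a c l m -> disc a = 0.
Proof.
move=> /factorsP[[e00 [e11 e22]] [e01 [e02 e12]]].
rewrite /disc e00 e11 e22 e01 e02 e12; ring.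
Qed.

Lemma det_mx22 (N : 'M[R]_2) : \det N = N 0 0 * N 1 1 - N 0 1 * N 1 0.
Proof.
rewrite (expand_det_row _ 0) !big_ord_recl big_ord0 /cofactor !det_mx11 !mxE /=.
rewrite expr0 mul1r expr1 mulN1r mulrN addr0.
by congr (_ * N _ _ - N _ _ * N _ _); apply: val_inj.
Qed.

Lemma det_mx33 B : \det B =
  B o0 o0 * (B o1 o1 * B o2 o2 - B o1 o2 * B o2 o1)
  - B o0 o1 * (B o1 o0 * B o2 o2 - B o1 o2 * B o2 o0)
  + B o0 o2 * (B o1 o0 * B o2 o1 - B o1 o1 * B o2 o0).
Proof.
rewrite (expand_det_row _ o0) big_ord3 /cofactor !det_mx22 !mxE /=.
have -> : lift o0 0 = o1 by apply: val_inj.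
have -> : lift o0 1 = o2 by apply: val_inj.
have -> : lift o1 0 = o0 by apply: val_inj.
have -> : lift o1 1 = o2 by apply: val_inj.
have -> : lift o2 0 = o0 by apply: val_inj.
have -> : lift o2 1 = o1 by apply: val_inj.
ring.
Qed.

(** [disc] is the half-discriminant, so this is a polynomial identity with integer coefficients,
    valid in characteristic 2 as well. *)
Lemma disc_subst B a : disc (subst B a) = \det B ^+ 2 * disc a.
Proof. by rewrite det_mx33 /disc !mxE !big_upper3 /=; ring. Qed.

(** An equality of polynomials is read off from its values at the points e_i, which give the
    diagonal coefficients, and at e_i + e_j, which then give the mixed ones. This works over any
    ring, however small. *)
Lemma qform_factors a c l m : 
  qform a = c *: (lform l * lform m) <-> factors a c l m.
Proof.
split=> [qa | /factorsP[[e00 [e11 e22]] [e01 [e02 e12]]]]; last first.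
  rewrite /qform /lform big_upper3 !big_ord3.
  rewrite e00 e11 e22 e01 e02 e12 -!mul_mpolyC; ring.
have {}qa v : \sum_(i < 3) \sum_(j < 3 | (i <= j)%N) a i j * (v i * v j)
    = c * ((\sum_i l 0 i * v i) * (\sum_i m 0 i * v i)).
  have := congr1 (meval v) qa.
  rewrite /qform /lform !big_upper3 !big_ord3.
  by rewrite !(mevalD, mevalZ, mevalM, mevalXU).
have diag i : a i i = c * (l 0 i * m 0 i).
  have := qa (fun j => (j == i)%:R); rewrite big_upper3 !big_ord3.
  by elim/forall_ord3: i => /=; rewrite !(mulr0, mulr1, addr0, add0r).
have off (i j : 'I_3) : (i < j)%N -> a i j = c * (l 0 i * m 0 j + l 0 j * m 0 i).
  move=> lt_ij; apply: (addrI (c * (l 0 i * m 0 i) + c * (l 0 j * m 0 j))).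
  transitivity (c * ((l 0 i + l 0 j) * (m 0 i + m 0 j))); last by ring.
  have := qa (fun k => ((k == i) || (k == j))%:R); rewrite big_upper3 !big_ord3.
  move: lt_ij; elim/forall_ord3: i; elim/forall_ord3: j => //= _;
    rewrite !(mulr0, mulr1, addr0, add0r) !diag => <-; ring.
move=> i j; rewrite leq_eqVlt => /orP[/eqP/val_inj <-|lt_ij].
  by rewrite eqxx addr0.
by rewrite off // neq_ltn lt_ij.
Qed.

End Forms.

(** * The four classes of conics and their stability under substitution *)

Section Classes.

Variable F : finFieldType.
Implicit Types (a b B : 'M[F]_3).

Lemma free2P (K : fieldType) (l m : 'rV[K]_3) :
  reflect (forall c d : K, c *: l + d *: m = 0 -> c = 0 /\ d = 0)
    (free [:: l; m]).
Proof.
apply: (iffP (@freeP _ _ _ [tuple l; m])) => [freelm c d eq0 | freelm k].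
  pose k (i : 'I_2) := if i == 0 then c else d.
  have k0: forall i, k i = 0.
    by apply: freelm; rewrite !big_ord_recl big_ord0 addr0.
  by split; [exact: (k0 0) | exact: (k0 1)].
rewrite !big_ord_recl big_ord0 addr0 => /freelm[k0 k1].
by case=> [[|[|i]]] // lti; [rewrite -k0 | rewrite -k1];
  congr (k _); apply: val_inj.
Qed.

Lemma free2_mulmxr (K : fieldType) (l m : 'rV[K]_3) (N : 'M[K]_3) :
  N \in unitmx -> free [:: l; m] -> free [:: l *m N; m *m N].
Proof.
move=> uN /free2P freelm; apply/free2P => c d.
rewrite !scalemxAl -mulmxDl => /(congr1 (mulmx^~ (invmx N))).
by rewrite mulmxK // mul0mx; apply: freelm.
Qed.

Lemma double_lineP a :
  reflect (exists c (l : 'rV[F]_3), [/\ c != 0, l != 0 & factors a c l l])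
    (double_line a).
Proof.
apply: (iffP existsP) => -[c] => [/existsP[l /and3P[c0 l0 /eqP eqa]]
                                 | [l [c0 l0 eqa]]].
  by exists c, l; split; rewrite // -qform_factors -expr2.
exists c; apply/existsP; exists l; rewrite c0 l0 expr2.
by apply/eqP/qform_factors.
Qed.

Lemma real_line_pairP a :
  reflect (exists l m : 'rV[F]_3, free [:: l; m] /\ factors a 1 l m)
    (real_line_pair a).
Proof.
apply: (iffP existsP) => -[l] => [/existsP[m /andP[flm /eqP eqa]]
                                 | [m [flm eqa]]].
  by exists l, m; split; rewrite // -qform_factors scale1r.
exists l; apply/existsP; exists m; rewrite flm.
by apply/eqP; rewrite -[RHS]scale1r; apply/qform_factors.
Qed.

Lemma nonsingular_conicE a : nonsingular_conic a = (disc a != 0).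
Proof. by []. Qed.

Definition subst_closed (C : pred 'M[F]_3) :=
  forall B a, B \in unitmx -> C a -> C (subst B a).

Lemma double_line_subst : subst_closed (@double_line F).
Proof.
move=> B a uB /double_lineP[c [l [c0 l0 eqa]]]; apply/double_lineP.
exists c, (l *m B^T); split=> //; last exact: factors_subst.
apply: contraNneq l0 => /(congr1 (mulmx^~ (invmx B^T))).
by rewrite mulmxK ?unitmx_tr // mul0mx => ->.
Qed.

Lemma real_line_pair_subst : subst_closed (@real_line_pair F).
Proof.
move=> B a uB /real_line_pairP[l [m [flm eqa]]]; apply/real_line_pairP.
exists (l *m B^T), (m *m B^T).
by split; [apply: free2_mulmxr; rewrite ?unitmx_tr | apply: factors_subst].
Qed.

Lemma nonsingular_conic_subst : subst_closed (@nonsingular_conic F).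
Proof.
move=> B a; rewrite unitmxE unitfE !nonsingular_conicE disc_subst => uB nza.
by rewrite mulf_neq0 ?expf_neq0.
Qed.

Section Imaginary.

Variables (E : finFieldType) (iota : {rmorphism F -> E}).

Definition frob (x : E) := x ^+ #|F|.

(** The order of [F] is a power of its characteristic, which [E] shares through [iota]. *)
Lemma frobD x y : frob (x + y) = frob x + frob y.
Proof.
have [p p_pr pcharF] := finPcharP F.
apply: exprDn_pchar.
rewrite (eq_pnat _ (fmorph_pchar iota)) (eq_pnat _ (pcharf_eq pcharF)) -cardsT.
exact: (pprimeChar_pgroup pcharF).
Qed.

Lemma frobM x y : frob (x * y) = frob x * frob y.
Proof. exact: exprMn. Qed.

Lemma frob0 : frob 0 = 0.
Proof. by rewrite /frob expr0n gtn_eqF // ltnW // finNzRing_gt1. Qed.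

Lemma frobN x : frob (- x) = - frob x.
Proof. by apply/eqP; rewrite -addr_eq0 -frobD addNr frob0. Qed.

Lemma frobV x : frob x^-1 = (frob x)^-1.
Proof. exact: exprVn. Qed.

Lemma frob_iota x : frob (iota x) = iota x.
Proof. by rewrite /frob -rmorphXn /= expf_card. Qed.

Lemma frob_eq0 x : (frob x == 0) = (x == 0).
Proof. by rewrite /frob expf_eq0 ltnW // finNzRing_gt1. Qed.

Lemma imag_line_pairP a :
  reflect (exists c (l : 'rV[E]_3),
             [/\ c != 0, free [:: l; map_mx frob l]
               & factors (map_mx iota a) (iota c) l (map_mx frob l)])
    (imag_line_pair iota a).
Proof.
have map_qform : map_mpoly iota (qform a) = qform (map_mx iota a).
  rewrite /qform !big_upper3 !rmorphD /= !map_mpolyZ !rmorphM /= !mxE.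
  by rewrite !map_mpolyX.
apply: (iffP existsP) => -[c] => [/existsP[l /and3P[c0 flm /eqP eqa]]
                                 | [l [c0 flm eqa]]].
  by exists c, l; split; rewrite // -qform_factors -map_qform.
exists c; apply/existsP; exists l; apply/and3P; split=> //.
by apply/eqP; rewrite map_qform; apply/qform_factors.
Qed.

(** The matrix [B] has entries in [F], which the Frobenius map fixes, so substitution sends
    conjugate linear forms to conjugate linear forms. *)
Lemma imag_line_pair_subst : subst_closed (imag_line_pair iota).
Proof.
move=> B a uB /imag_line_pairP[c [l [c0 flm eqa]]]; apply/imag_line_pairP.
pose N := (map_mx iota B)^T.
have uN : N \in unitmx by rewrite unitmx_tr map_unitmx.
have frobN : map_mx frob (l *m N) = map_mx frob l *m N.
  by apply/matrixP=> i j; rewrite !mxE !big_ord3 !mxE !frobD !frobM !frob_iota.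
exists c, (l *m N); rewrite frobN; split=> //; first exact: free2_mulmxr.
have -> : map_mx iota (subst B a) = subst (map_mx iota B) (map_mx iota a).
  apply/matrixP=> i j; rewrite !mxE !big_upper3 !mxE; ring.
exact: factors_subst.
Qed.

End Imaginary.

(** * Hyperplanes under the action of K and under scaling of the form *)

Lemma pg_point_mem (M : 'M[F]_3) : M \in pg_point M.
Proof. by apply/imsetP; exists 1; rewrite ?inE ?oner_eq0 ?scale1r. Qed.

Lemma mem_hyperplane a P :
  reflect (exists M, [/\ M^T = M, M != 0, pairing a M = 0 & P = pg_point M])
    (P \in hyperplane a).
Proof.
rewrite inE; apply: (iffP andP) => [[/imsetP[M] /[!inE]] | [M [symM M0 aM ->]]].
  move=> /andP[/eqP symM M0] -> /forall_inP/(_ M (pg_point_mem M))/eqP aM.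
  by exists M; split.
split; first by apply/imsetP; exists M; rewrite ?inE ?symM ?eqxx.
apply/forall_inP=> _ /imsetP[c _ ->]; apply/eqP.
rewrite -[RHS](mulr0 c) -[in RHS]aM /pairing !big_upper3 !mxE; ring.
Qed.

Lemma pg_point_hyperplane a (M : 'M[F]_3) :
  M^T = M -> M != 0 -> (pg_point M \in hyperplane a) = (pairing a M == 0).
Proof.
move=> symM M0; apply/idP/eqP => [|aM]; last by apply/mem_hyperplane; exists M.
by rewrite inE => /andP[_ /forall_inP/(_ M (pg_point_mem M))/eqP].
Qed.

Lemma K_act_point (A M : 'M[F]_3) :
  K_act A (pg_point M) = pg_point (A *m M *m A^T).
Proof.
rewrite /K_act /pg_point -imset_comp; apply: eq_imset => c /=.
by rewrite -scalemxAr -scalemxAl.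
Qed.

Lemma K_actK (A : 'M[F]_3) : A \in unitmx -> cancel (K_act A) (K_act (invmx A)).
Proof.
move=> uA P; rewrite /K_act -imset_comp -[RHS]imset_id; apply: eq_imset => M /=.
by rewrite trmx_inv !mulmxA mulVmx // mul1mx mulmxK // unitmx_tr.
Qed.

(** The group acts on hyperplanes by the contragredient substitution: by [pairing_subst], pairing
    the new form with A M A^T gives back the pairing of [a] with M. *)
Lemma K_act_hyperplane (A a : 'M[F]_3) : A \in unitmx ->
  K_act A @: hyperplane a = hyperplane (subst (invmx A)^T a).
Proof.
move=> uA; apply/setP=> P; apply/imsetP/mem_hyperplane.
  case=> _ /mem_hyperplane[M [symM M0 aM ->]] ->.
  exists (A *m M *m A^T); rewrite K_act_point; split=> //.
  - by rewrite !trmx_mul trmxK symM mulmxA.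
  - apply: contraNneq M0 => /(congr1 (fun N => invmx A *m N *m invmx A^T)).
    by rewrite mulmx0 mul0mx !mulmxA mulVmx // mul1mx mulmxK ?unitmx_tr // => ->.
  - rewrite pairing_subst ?trmxK; last by rewrite !trmx_mul trmxK symM mulmxA.
    by rewrite trmx_inv !mulmxA mulVmx // mul1mx mulmxK ?unitmx_tr.
case=> N [symN N0 aN ->].
have eqN : N = A *m (invmx A *m N *m (invmx A)^T) *m A^T.
  by rewrite trmx_inv !mulmxA mulmxV // mul1mx mulmxKV ?unitmx_tr.
exists (pg_point (invmx A *m N *m (invmx A)^T)); last by rewrite K_act_point -eqN.
apply/mem_hyperplane; eexists; split; last by [].
- by rewrite !trmx_mul trmxK symN mulmxA.
- by apply: contraNneq N0 => eq0; rewrite eqN eq0 mulmx0 mul0mx.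
by rewrite pairing_subst // trmxK in aN.
Qed.

(** Only entries on or above the diagonal are compared. With k = 1 this also allows the irrelevant
    entries below the diagonal to be changed. *)
Definition scale_closed (C : pred 'M[F]_3) := forall k a b, k != 0 ->
  (forall i j : 'I_3, (i <= j)%N -> b i j = k * a i j) -> C a -> C b.

Lemma double_line_scale : scale_closed (@double_line F).
Proof.
move=> k a b k0 eqb /double_lineP[c [l [c0 l0 eqa]]]; apply/double_lineP.
exists (k * c), l; split; rewrite ?mulf_neq0 // => i j le_ij.
by rewrite eqb // eqa // mulrA.
Qed.

Lemma real_line_pair_scale : scale_closed (@real_line_pair F).
Proof.
move=> k a b k0 eqb /real_line_pairP[l [m [/free2P flm eqa]]].
apply/real_line_pairP; exists (k *: l), m; split=> [|i j le_ij].
  apply/free2P => c d; rewrite scalerA => /flm[/eqP ck0 ->]; split=> //.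
  by apply/eqP; rewrite mulf_eq0 (negPf k0) orbF in ck0.
by rewrite eqb // eqa // !mxE; ring.
Qed.

Lemma imag_line_pair_scale (E : finFieldType) (iota : {rmorphism F -> E}) :
  scale_closed (imag_line_pair iota).
Proof.
move=> k a b k0 eqb /imag_line_pairP[c [l [c0 flm eqa]]].
apply/imag_line_pairP; exists (k * c), l; split; rewrite ?mulf_neq0 //.
move=> i j le_ij; have := eqa i j le_ij; rewrite !mxE eqb // !rmorphM /= => ->.
by rewrite mulrA.
Qed.

Lemma nonsingular_conic_scale : scale_closed (@nonsingular_conic F).
Proof.
move=> k a b k0 eqb; rewrite !nonsingular_conicE => da0.
have -> : disc b = k ^+ 3 * disc a by rewrite /disc !eqb //; ring.
by rewrite mulf_neq0 ?expf_neq0.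
Qed.

Lemma hyperplane_scale (k : F) a b : k != 0 ->
  (forall i j : 'I_3, (i <= j)%N -> b i j = k * a i j) ->
  hyperplane b = hyperplane a.
Proof.
move=> k0 eqb; apply/setP=> P; rewrite !inE; congr (_ && _).
have pairb M : pairing b M = k * pairing a M.
  by rewrite /pairing !big_upper3 !eqb //; ring.
apply/forall_inP/forall_inP=> memP M /memP.
  by rewrite -/(pairing b M) -/(pairing a M) pairb mulf_eq0 (negPf k0).
by rewrite -/(pairing b M) -/(pairing a M) pairb mulf_eq0 (negPf k0).
Qed.

(** A hyperplane determines its form up to a scalar, expressed by vanishing 2 x 2 minors of the
    coefficient vectors. The combination [M] of two coordinate matrices is chosen to lie on the
    hyperplane of [a]; lying on that of [b] is the claimed equation. *)
Lemma hyperplane_cross a b (i j k n : 'I_3) : (i <= j)%N -> (k <= n)%N ->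
  hyperplane a = hyperplane b -> a i j * b k n = a k n * b i j.
Proof.
move=> le_ij le_kn eqab.
(* The boolean disjunction makes the diagonal entry of [S i i] equal to 1 rather than 2, so [S]
   picks out a coefficient in every characteristic. *)
pose S (i j : 'I_3) : 'M[F]_3 :=
  \matrix_(k, n) (((k == i) && (n == j)) || ((k == j) && (n == i)))%:R.
have symS x y : (S x y)^T = S x y.
  by apply/matrixP=> z t; rewrite !mxE orbC andbC [X in _ || X]andbC.
have pairS c (x y : 'I_3) : (x <= y)%N -> pairing c (S x y) = c x y.
  rewrite /pairing big_upper3 !mxE.
  by elim/forall_ord3: x; elim/forall_ord3: y => //= _;
    rewrite !(mulr0, mulr1, addr0, add0r).
pose M := a i j *: S k n - a k n *: S i j.
have pairM c : pairing c M = a i j * c k n - a k n * c i j.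
  rewrite -[in RHS](pairS c i j) // -[in RHS](pairS c k n) //.
  rewrite /pairing !big_upper3 !mxE; ring.
apply/eqP; rewrite -subr_eq0 -pairM.
(* The zero matrix represents no point, so it is treated apart. *)
have [-> | M0] := eqVneq M 0.
  by rewrite /pairing big_upper3 !mxE !mulr0 !addr0.
have symM : M^T = M by rewrite /M linearB /= !linearZ /= !symS.
by rewrite -pg_point_hyperplane // -eqab pg_point_hyperplane // pairM mulrC subrr.
Qed.

(** The action of [A] injects the hyperplanes of the class through a line into those through its
    image; the inverse of [A] gives the opposite inequality. *)
Lemma num_hyperplanes_K_orbit (C : pred 'M[F]_3) (L L' : {set {set 'M[F]_3}}) :
  subst_closed C -> L' \in K_orbit L ->
  num_hyperplanes C L' = num_hyperplanes C L.
Proof.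
move=> closedC.
have leK (A : 'M[F]_3) L1 : A \in unitmx ->
    (num_hyperplanes C L1 <= num_hyperplanes C (K_act A @: L1))%N.
  move=> uA; have injA := imset_inj (can_inj (K_actK uA)).
  rewrite /num_hyperplanes -(card_imset _ injA).
  apply/subset_leq_card/subsetP=> _ /imsetP[H + ->].
  rewrite !inE => /andP[/imsetP[a /[!inE] Ca ->] sLH]; rewrite imsetS // andbT.
  rewrite K_act_hyperplane //; apply: imset_f; rewrite inE.
  by apply: closedC; rewrite ?unitmx_tr ?unitmx_inv.
case/imsetP=> A /[!inE] uA ->; apply/eqP; rewrite eqn_leq (leK A) // andbT.
have {2}-> : L = K_act (invmx A) @: (K_act A @: L).
  by rewrite -imset_comp -[LHS]imset_id; apply: eq_imset => P /=; rewrite K_actK.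
by rewrite leK ?unitmx_inv.
Qed.

End Classes.

(** * Quadratic extensions of finite fields *)

Lemma quadratic_root (F E : finFieldType) (iota : {rmorphism F -> E})
    (p : {poly F}) :
  #|E| = (#|F| ^ 2)%N -> size p = 3 -> (forall x, ~~ root p x) ->
  exists t : E, root (map_poly iota p) t.
Proof.
move=> cardE size_p no_root.
have irr_p : irreducible_poly p by apply: cubic_irreducible; rewrite ?size_p.
pose r : {poly F} := 'X^(#|F| ^ 2) - 'X.
(* A root z of p in a quadratic extension K of F satisfies z^(q^2) = z, so p and r are not coprime.
   As p is irreducible, it divides r. *)
have dvd_pr : p %| r.
  have [K dimK [z pz0 _]] := irredp_FAdjoin irr_p.
  apply: contraLR pz0; rewrite -irreducible_poly_coprime //.
  rewrite -(coprimep_map (in_alg K)) => /coprimep_root co_pr.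
  apply/negP => /co_pr/eqP; apply.
  rewrite rmorphB /= map_polyXn map_polyX !hornerE.
  have cardK : #|FinFieldExtType K| = (#|F| ^ 2)%N.
    have : #|{: finvect_type K}%VS| = (#|F| ^ \dim {: K})%N by apply: card_vspace.
    by rewrite card_vspacef dimK size_p.
  by apply/eqP; rewrite subr_eq0 -cardK (@expf_card (FinFieldExtType K) z).
(* Over [E] the polynomial r is the product of all X - x, so p becomes, up to a scalar, a
   subproduct; its size 3 makes that subproduct nonempty. *)
have : map_poly iota p %| \prod_(x : E) ('X - x%:P).
  rewrite -finField_genPoly cardE.
  have -> : 'X^(#|F| ^ 2) - 'X = map_poly iota r.
    by rewrite rmorphB /= map_polyXn map_polyX.
  by rewrite dvdp_map.
case/dvdp_prod_XsubC=> m eqp_p.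
have := eqp_size eqp_p; rewrite size_map_poly size_p.
case def_s: (mask m _) => [|t s]; first by rewrite big_nil size_poly1.
move=> _; exists t; rewrite (eqp_root eqp_p) def_s big_cons.
by rewrite rootM root_XsubC eqxx.
Qed.

(** Evaluate X^q - X, the product of the X - x for x in [F], at [t]. *)
Lemma frob_fixed (F E : finFieldType) (iota : {rmorphism F -> E}) (t : E) :
  t ^+ #|F| = t -> exists x, t = iota x.
Proof.
move=> fix_t; have := congr1 (fun p => (map_poly iota p).[t]) (finField_genPoly F).
rewrite rmorphB /= map_polyXn map_polyX !hornerE fix_t subrr rmorph_prod horner_prod.
move/esym/eqP/prodf_eq0=> [x _]; rewrite rmorphB /= map_polyX map_polyC /= !hornerE.
by rewrite subr_eq0 => /eqP; exists x.
Qed.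

(** * The conics whose hyperplanes contain the representative line *)

Section Net.

Variables (F : finFieldType) (u v0 : F).
Hypothesis uv_param : o10_param u v0.

Let v0_neq0 : v0 != 0. Proof. by case/andP: uv_param. Qed.

Definition net (al b c d : F) : 'M[F]_3 :=
  \matrix_(i, j) nth 0 (nth [::]
    [:: [:: al; u * v0 * al; b]; [:: 0; - v0 * al; c]; [:: 0; 0; d]] i) j.

(** For x nonzero, this is the admissibility condition at l = y / x, multiplied by - x^2. *)
Lemma no_zero (x y : F) : x ^+ 2 - u * v0 * x * y - v0 * y ^+ 2 = 0 -> x = 0.
Proof.
move=> eq0; apply/eqP; apply: contraT => x0.
have /andP[_ /forallP/(_ (y / x))] := uv_param.
rewrite (_ : _ - 1 = - (x ^+ 2 - u * v0 * x * y - v0 * y ^+ 2) / x ^+ 2).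
  by rewrite eq0 oppr0 mul0r eqxx.
by field.
Qed.

(** The pairing is linear along the line, so the points with parameters (1, 0) and (0, 1) give the
    two equations. *)
Lemma sub_o10_line (a : 'M[F]_3) :
  (o10_line u v0 \subset hyperplane a)
    = (a o1 o1 == - v0 * a o0 o0) && (a o0 o1 == u * v0 * a o0 o0).
Proof.
have sym y0 y1 y2 y3 y4 y5 : (@sym_mx F y0 y1 y2 y3 y4 y5)^T
    = sym_mx y0 y1 y2 y3 y4 y5.
  by apply/matrixP; elim/forall_ord3; elim/forall_ord3; rewrite !mxE.
have pair z : pairing a (sym_mx (v0 * z.1) z.2 0 (z.1 + u * z.2) 0 0)
    = z.1 * (a o1 o1 + v0 * a o0 o0) + z.2 * (a o0 o1 + u * a o1 o1).
  by rewrite /pairing big_upper3 !mxE /=; ring.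
have nz z : z != (0, 0) -> sym_mx (v0 * z.1) z.2 0 (z.1 + u * z.2) 0 0 != 0.
  case: z => x y /=; apply: contraNneq => /matrixP eq0.
  have := eq0 o0 o0; have := eq0 o0 o1; rewrite !mxE /= => -> /eqP.
  by rewrite mulf_eq0 (negPf v0_neq0) => /eqP->.
apply/subsetP/andP => [sub | [/eqP e11 /eqP e01] _ /imsetP[z z0 ->]].
  have mem z : z != (0, 0) ->
      z.1 * (a o1 o1 + v0 * a o0 o0) + z.2 * (a o0 o1 + u * a o1 o1) = 0.
    move=> z0; rewrite -pair; apply/eqP.
    rewrite -pg_point_hyperplane ?nz //; apply: sub.
    by apply/imsetP; exists z; rewrite ?inE.
  have := mem (1, 0); have := mem (0, 1).
  rewrite !xpair_eqE oner_eq0 andbF /= !(mul0r, mul1r, addr0, add0r).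
  move=> /(_ isT)/eqP; rewrite addr_eq0 => /eqP-> /(_ isT)/eqP.
  by rewrite addr_eq0 => /eqP->; split; apply/eqP; ring.
rewrite inE in z0.
by rewrite pg_point_hyperplane ?nz // pair e11 e01; apply/eqP; ring.
Qed.

Lemma net_sub (al b c d : F) : o10_line u v0 \subset hyperplane (net al b c d).
Proof. by rewrite sub_o10_line !mxE !eqxx. Qed.

Definition hyperplanes_on (C : pred 'M[F]_3) :=
  [set H in hyperplanes_of C | o10_line u v0 \subset H].

(** The leading coefficient is normalized to 0 or 1 by scaling; in the first case the factor is 1
    and only entries below the diagonal change. *)
Lemma hyperplanes_onP (C : pred 'M[F]_3) H : scale_closed C ->
  reflect (exists al b c d, [/\ al = 0 \/ al = 1, C (net al b c d)
                               & H = hyperplane (net al b c d)])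
    (H \in hyperplanes_on C).
Proof.
move=> scC; rewrite inE; apply: (iffP andP); last first.
  case=> al [b [c [d [_ Cn ->]]]]; rewrite net_sub; split=> //.
  by apply/imsetP; exists (net al b c d); rewrite ?inE.
case=> /imsetP[a /[!inE] Ca ->]; rewrite sub_o10_line => /andP[/eqP e11 /eqP e01].
have [a0 | a0] := eqVneq (a o0 o0) 0.
  have eqn (i j : 'I_3) : (i <= j)%N ->
      net 0 (a o0 o2) (a o1 o2) (a o2 o2) i j = 1 * a i j.
    by elim/forall_ord3: i; elim/forall_ord3: j => //= _;
      rewrite !mxE /= ?e11 ?e01 ?a0 ?mulr0 ?mul1r.
  exists 0, (a o0 o2), (a o1 o2), (a o2 o2).
  split; first by left.
    exact: scC (oner_neq0 _) eqn Ca.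
  by rewrite (hyperplane_scale (oner_neq0 _) eqn).
have k0 : (a o0 o0)^-1 != 0 by rewrite invr_eq0.
have eqn (i j : 'I_3) : (i <= j)%N ->
    net 1 ((a o0 o0)^-1 * a o0 o2) ((a o0 o0)^-1 * a o1 o2)
      ((a o0 o0)^-1 * a o2 o2) i j = (a o0 o0)^-1 * a i j.
  by elim/forall_ord3: i; elim/forall_ord3: j => //= _;
     rewrite !mxE /= ?e11 ?e01; field.
do 4!eexists; split; first by right.
  exact: scC k0 eqn Ca.
by rewrite (hyperplane_scale k0 eqn).
Qed.

Lemma disc_net al b c d : disc (net al b c d) =
  al * (u * v0 * b * c - c ^+ 2 + v0 * b ^+ 2
        - (u ^+ 2 * v0 ^+ 2 + 4%:R * v0) * (al * d)).
Proof. by rewrite /disc !mxE /=; ring. Qed.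

(* The conics with al = 1 have no point over F on the line X2 = 0. *)
Lemma net1_nofactor b c d k (l m : 'rV[F]_3) : ~ factors (net 1 b c d) k l m.
Proof.
move=> /factorsP; rewrite !mxE /= => -[[e00 [e11 _]] [e01 _]].
have l1 : l 0 o1 = 0.
  (* On X2 = 0 the linear form [l] vanishes at (l1, - l0), where the conic must vanish too; this
     explains the sign of the middle term in [no_zero]. *)
  apply: (@no_zero (l 0 o1) (l 0 o0)).
  have -> : l 0 o1 ^+ 2 - u * v0 * l 0 o1 * l 0 o0 - v0 * l 0 o0 ^+ 2
    = 1 * l 0 o1 ^+ 2 - (u * v0 * 1) * l 0 o1 * l 0 o0 + (- v0 * 1) * l 0 o0 ^+ 2
    by ring.
  by rewrite {1}e00 e11 e01; ring.
move/eqP: e11; rewrite l1 !mul0r mulr0 mulr1 oppr_eq0.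
by rewrite (negPf v0_neq0).
Qed.

Lemma num_double_line : #|hyperplanes_on (@double_line F)| = 1%N.
Proof.
suff -> : hyperplanes_on (@double_line F) = [set hyperplane (net 0 0 0 1)].
  exact: cards1.
apply/setP=> H; rewrite in_set1.
apply/(hyperplanes_onP _ (@double_line_scale F))/eqP; last first.
  move=> ->; exists 0, 0, 0, 1; split=> //; first by left.
  apply/double_lineP; exists 1, (\row_j (j == o2)%:R); split; first exact: oner_neq0.
    by apply/eqP=> /rowP/(_ o2)/eqP; rewrite !mxE oner_eq0.
  by apply/factorsP; rewrite !mxE /=; do !split; ring.
case=> _ [b [c [d [[]-> /double_lineP[k [l [k0 l0]]]]]]]; last by move/net1_nofactor.
move=> /factorsP; rewrite !mxE /= => -[[e00 [e11 e22]] [_ [e02 e12]]] ->.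
have l00 : l 0 o0 = 0.
  by move/esym/eqP: e00; rewrite !mulf_eq0 (negPf k0) orbb => /eqP.
have l01 : l 0 o1 = 0.
  move/esym/eqP: e11; rewrite mulr0 !mulf_eq0 (negPf k0) orbb => /eqP.
  by [].
move: e02 e12; rewrite l00 l01 !(mul0r, mulr0, addr0) => -> ->.
have d0 : d != 0.
  rewrite e22 !mulf_neq0 //; apply: contraNneq l0 => l02;
  by apply/eqP/rowP; elim/forall_ord3; rewrite mxE.
apply: (hyperplane_scale d0); elim/forall_ord3; elim/forall_ord3 => //= _;
  by rewrite !mxE /= ?mulr0 ?mulr1.
Qed.

(** If b = c = 0 the form is d X2^2, and two nonzero factors of it must both be multiples of X2,
    hence proportional. Otherwise X2 and b X0 + c X1 + d X2 are independent factors. *)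
Lemma real_net0 b c d : real_line_pair (net 0 b c d) = ((b, c) != (0, 0)).
Proof.
apply/real_line_pairP/idP => [[l [m [/free2P flm]]] | bc0].
  move=> /factorsP; rewrite !mxE /= => -[[e00 [e11 e22]] [e01 [e02 e12]]].
  apply/eqP=> -[b0 c0]; rewrite b0 c0 !mul1r ?mulr0 in e00 e11 e01 e02 e12.
  have flm' x y : x * l 0 o0 + y * m 0 o0 = 0 -> x * l 0 o1 + y * m 0 o1 = 0 ->
      x * l 0 o2 + y * m 0 o2 = 0 -> x = 0 /\ y = 0.
    by move=> h0 h1 h2; apply: flm; apply/rowP; elim/forall_ord3; rewrite !mxE.
  have nl : ~ (l 0 o0 = 0 /\ l 0 o1 = 0 /\ l 0 o2 = 0).
    case=> l0 [l1 l2]; have [|||/eqP] := flm' 1 0; rewrite ?l0 ?l1 ?l2;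
      rewrite ?oner_eq0 //;
      by rewrite mulr0 mul0r addr0.
  have nm : ~ (m 0 o0 = 0 /\ m 0 o1 = 0 /\ m 0 o2 = 0).
    case=> m0 [m1 m2]; have [|||_ /eqP] := flm' 0 1; rewrite ?m0 ?m1 ?m2;
      rewrite ?oner_eq0 //;
      by rewrite mulr0 mul0r addr0.
  have eq0 (x y : F) : 0 = x * y -> x != 0 -> y = 0.
    by move=> /esym/eqP + /negPf x0; rewrite mulf_eq0 x0 => /eqP.
  have [l0 | l0] := eqVneq (l 0 o0) 0; last first.
    have m0 := eq0 _ _ e00 l0; rewrite m0 !mulr0 ?addr0 in e01 e02.
    by apply: nm; rewrite m0 (eq0 _ _ e01 l0) (eq0 _ _ e02 l0).
  rewrite l0 !mul0r ?add0r in e01 e02.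
  have [m0 | m0] := eqVneq (m 0 o0) 0; last first.
    rewrite mulrC in e01; rewrite mulrC in e02.
    by apply: nl; rewrite l0 (eq0 _ _ e01 m0) (eq0 _ _ e02 m0).
  have [l1 | l1] := eqVneq (l 0 o1) 0; last first.
    have m1 := eq0 _ _ e11 l1; rewrite m1 mulr0 addr0 in e12.
    by apply: nm; rewrite m0 m1 (eq0 _ _ e12 l1).
  rewrite l1 mul0r add0r mulrC in e12.
  have [m1 | m1] := eqVneq (m 0 o1) 0; last first.
    by apply: nl; rewrite l0 l1 (eq0 _ _ e12 m1).
  (* Now both forms are multiples of X2, and m2 l - l2 m = 0 is a dependence. *)
  have [||| _ /eqP] := flm' (m 0 o2) (- l 0 o2); rewrite ?l0 ?l1 ?m0 ?m1; try ring.
  by rewrite oppr_eq0 => /eqP l2; apply: nl.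
exists (\row_j (j == o2)%:R).
exists (\row_j (if j == o0 then b else if j == o1 then c else d)); split.
  apply/free2P=> x y /rowP eq0; have := eq0 o0; have := eq0 o1; have := eq0 o2.
  rewrite !mxE /= !mulr0 !add0r mulr1 => e2 /eqP + /eqP.
  rewrite !mulf_eq0; case: (eqVneq y 0) e2 => [-> | _ _] /=.
    by rewrite mul0r addr0.
  by move=> /eqP c0 /eqP b0; rewrite b0 c0 eqxx in bc0.
by apply/factorsP; rewrite !mxE /=; do !split; ring.
Qed.

(** Up to scalars either b = 1, with c and d free, or b = 0 and c = 1, with d free. *)
Lemma num_real_line_pair :
  #|hyperplanes_on (@real_line_pair F)| = (#|F| ^ 2 + #|F|)%N.
Proof.
pose f1 (z : F * F) := hyperplane (net 0 1 z.1 z.2).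
pose f2 d := hyperplane (net 0 0 1 d).
have inj1 : injective f1.
  move=> [c d] [c' d'] eqf.
  have := hyperplane_cross (i := o0) (j := o2) (k := o1) (n := o2) isT isT eqf.
  have := hyperplane_cross (i := o0) (j := o2) (k := o2) (n := o2) isT isT eqf.
  by rewrite !mxE /= !mul1r !mulr1 => -> ->.
have inj2 : injective f2.
  move=> d d' eqf.
  have := hyperplane_cross (i := o1) (j := o2) (k := o2) (n := o2) isT isT eqf.
  by rewrite !mxE /= !mul1r !mulr1 => ->.
have -> : hyperplanes_on (@real_line_pair F) = f1 @: setT :|: f2 @: setT.
  apply/setP=> H; rewrite in_setU.
  apply/(hyperplanes_onP _ (@real_line_pair_scale F))/orP; last first.
    case=> /imsetP[z _ ->].
      exists 0, 1, z.1, z.2; split=> //; first by left.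
      by rewrite real_net0 xpair_eqE oner_eq0.
    exists 0, 0, 1, z; split=> //; first by left.
    by rewrite real_net0 xpair_eqE oner_eq0 andbF.
  case=> _ [b [c [d [[]->]]]]; last first.
    by case/real_line_pairP=> l [m [_ /net1_nofactor]].
  rewrite real_net0 xpair_eqE => bc0 ->.
  have [b0 | b0] := eqVneq b 0; [right | left].
    have c0 : c != 0 by rewrite b0 eqxx in bc0.
    apply/imsetP; exists (c^-1 * d) => //.
    apply: (hyperplane_scale c0); elim/forall_ord3; elim/forall_ord3 => //= _;
      by rewrite !mxE /= ?b0; field.
  apply/imsetP; exists (b^-1 * c, b^-1 * d) => //.
  apply: (hyperplane_scale b0); elim/forall_ord3; elim/forall_ord3 => //= _;
    by rewrite !mxE /=; field.
rewrite cardsU !card_imset // !cardsT card_prod.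
rewrite (_ : _ :&: _ = set0) ?cards0 ?subn0 ?mulnn //.
apply/setP=> H; rewrite !inE; apply/andP=> -[/imsetP[z _ ->] /imsetP[d _ eqf]].
have := hyperplane_cross (i := o0) (j := o2) (k := o1) (n := o2) isT isT eqf.
by rewrite !mxE /= mulr1 mulr0 => /eqP; rewrite oner_eq0.
Qed.

(** * Singular and nonsingular conics with al = 1, using the field [E] *)

Section Counting.

Variables (E : finFieldType) (iota : {rmorphism F -> E}).
Hypothesis cardE : #|E| = (#|F| ^ 2)%N.

(** The root [t] of X^2 - u v0 X - v0 is not in [F], so its conjugate is the other root, and the
    last two equations are the relations of Vieta. *)
Lemma net_root : exists t : E,
  [/\ t != frob F t, t + frob F t = iota (u * v0) & t * frob F t = - iota v0].
Proof.
pose p : {poly F} := 'X^2 - (u * v0)%:P * 'X - v0%:P.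
have p_at x : p.[x] = x ^+ 2 - u * v0 * x - v0 by rewrite /p !hornerE.
have size_p : size p = 3.
  rewrite /p -addrA -opprD size_polyDl size_polyXn // size_polyN size_MXaddC.
  by case: ifP => // _; rewrite ltnS size_polyC; case: (u * v0 != 0).
have no_root x : ~~ root p x.
  apply/rootP; rewrite p_at => px0.
  have x0 : x = 0 by apply: (@no_zero x 1); rewrite -px0; ring.
  move/eqP: px0; rewrite x0 expr0n mulr0 subr0 sub0r oppr_eq0.
  by rewrite (negPf v0_neq0).
have [t pt0] := quadratic_root iota cardE size_p no_root.
have t2 : t ^+ 2 = iota (u * v0) * t + iota v0.
  move: pt0; rewrite /root /p !rmorphB /= map_polyXn map_polyC.
  rewrite [map_poly _ (_ * _)]rmorphM /= map_polyX map_polyC !hornerE.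
  by rewrite -addrA -opprD subr_eq0 => /eqP.
have T2 : frob F t ^+ 2 = iota (u * v0) * frob F t + iota v0.
  have := congr1 (@frob F E) t2; rewrite (frobD iota) frobM !frob_iota => <-.
  by rewrite !expr2 frobM.
have tT : t != frob F t.
  apply/eqP=> /esym/(frob_fixed iota)[x tx].
  have /negP[] := no_root x; rewrite /root p_at -(fmorph_eq0 iota).
  have -> : iota (x ^+ 2 - u * v0 * x - v0) = t ^+ 2 - iota (u * v0) * t - iota v0.
    by rewrite tx; ring.
  by rewrite t2; apply/eqP; ring.
have tD : t + frob F t = iota (u * v0).
  have tT' : t - frob F t != 0 by rewrite subr_eq0.
  apply: (mulfI tT').
  transitivity (t ^+ 2 - frob F t ^+ 2); first by ring.
  by rewrite t2 T2; ring.
exists t; split=> //.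
have -> : t * frob F t = (t + frob F t) * t - t ^+ 2 by ring.
by rewrite tD t2; ring.
Qed.

Lemma net_disc_neq0 : u ^+ 2 * v0 ^+ 2 + 4%:R * v0 != 0.
Proof.
have [t [tT tD tM]] := net_root.
rewrite -(fmorph_eq0 iota).
have -> : iota (u ^+ 2 * v0 ^+ 2 + 4%:R * v0) = (t - frob F t) ^+ 2.
  transitivity (iota (u * v0) ^+ 2 - 4%:R * (- iota v0)); first by ring.
  by rewrite -tD -tM; ring.
by rewrite expf_neq0 // subr_eq0.
Qed.

(** The value of d at which [disc (net 1 b c d)], affine in d, vanishes for z = (b, c). *)
Definition net_apex (z : F * F) : F :=
  (u * v0 * z.1 * z.2 - z.2 ^+ 2 + v0 * z.1 ^+ 2)
    / (u ^+ 2 * v0 ^+ 2 + 4%:R * v0).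

Lemma disc_net1_eq0 b c d :
  (disc (net 1 b c d) == 0) = (d == net_apex (b, c)).
Proof.
have D0 := net_disc_neq0.
rewrite disc_net !mul1r subr_eq0 /net_apex /=.
by apply/eqP/eqP=> [-> | ->]; [rewrite mulrC mulKf | rewrite [RHS]mulrC divfK].
Qed.

Lemma imag_net1 b c d :
  imag_line_pair iota (net 1 b c d) = (d == net_apex (b, c)).
Proof.
rewrite -disc_net1_eq0; apply/imag_line_pairP/eqP => [[k [l [_ _ fact]]] | disc0].
  apply/eqP; rewrite -(fmorph_eq0 iota) -(disc_factors fact).
  by rewrite /disc !mxE; apply/eqP; ring.
have [t [tT tD tM]] := net_root.
have tT' : frob F t - t != 0 by rewrite subr_eq0 eq_sym.
have Tt' : t - frob F t != 0 by rewrite subr_eq0.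
have frobK : frob F (frob F t) = t.
  by rewrite /frob -exprM mulnn -cardE expf_card.
(* The factor sought is X0 + t X1 + e X2. Comparing the coefficients of X0 X2 and X1 X2 gives e +
   e^q = b and t e^q + t^q e = c, a linear system with this solution; the vanishing discriminant
   then says e e^q = d. *)
pose e := (iota c - t * iota b) / (frob F t - t).
have frob_e : frob F e = (iota c - frob F t * iota b) / (t - frob F t).
  rewrite /e frobM frobV !(frobD iota) !(frobN iota) frobM !frob_iota.
  by rewrite frobK.
pose l : 'rV[E]_3 := \row_j (if j == o0 then 1 else if j == o1 then t else e).
have frob1 : frob F (1 : E) = 1 by rewrite /frob expr1n.
exists 1, l; split; first exact: oner_neq0.
  apply/free2P=> x y /rowP eq0.
  have := eq0 o0; have := eq0 o1; rewrite !mxE /= frob1 !mulr1 => e1 e0.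
  have /eqP : x * (t - frob F t) = 0.
    transitivity (x * t + y * frob F t - (x + y) * frob F t); first by ring.
    by rewrite e1 e0 mul0r subr0.
  rewrite mulf_eq0 (negPf Tt') orbF => /eqP x0; split=> //.
  by rewrite x0 add0r in e0.
apply/factorsP; rewrite !mxE /= frob1 frob_e /e !rmorph1 !rmorphM !rmorphN.
rewrite !rmorph1 !mul1r.
have dE : iota d * (t - frob F t) ^+ 2
    = - ((iota c - t * iota b) * (iota c - frob F t * iota b)).
  have := congr1 iota disc0; rewrite disc_net rmorph0 !mul1r => /eqP.
  rewrite rmorphB subr_eq0 => /eqP eqd.
  transitivity (iota d * ((t + frob F t) ^+ 2 - 4%:R * (t * frob F t))); first by ring.
  transitivity (iota ((u ^+ 2 * v0 ^+ 2 + 4%:R * v0) * d)).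
    by rewrite tD tM; ring.
  rewrite -eqd.
  transitivity ((t + frob F t) * iota b * iota c - iota c ^+ 2 
    - (t * frob F t) * iota b ^+ 2); last by ring.
  by rewrite tD tM; ring.
do !split.
- by rewrite tM -rmorphN mulr1.
- apply: (mulIf (expf_neq0 2 Tt')); rewrite dE; field.
  by rewrite tT' Tt'.
- by rewrite -rmorphM mulr1 -tD; ring.
- by field; rewrite tT' Tt'.
- by field; rewrite tT' Tt'.
Qed.

(** The coefficients of X0^2 and X1^2 are [k] times x x^q, with x the corresponding coefficient of
    [l]. They vanish, so [l] is a multiple of X2 and proportional to its conjugate. *)
Lemma imag_net0 b c d : ~~ imag_line_pair iota (net 0 b c d).
Proof.
apply/imag_line_pairP=> -[k [l [k0 /free2P flm]]].
move=> /factorsP; rewrite !mxE /= !mulr0 !rmorph0 => -[[e00 [e11 _]] _].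
have ik0 : iota k != 0 by rewrite fmorph_eq0.
have l0 : l 0 o0 = 0.
  by move/esym/eqP: e00; rewrite !mulf_eq0 (negPf ik0) frob_eq0 orbb => /eqP.
have l1 : l 0 o1 = 0.
  by move/esym/eqP: e11; rewrite !mulf_eq0 (negPf ik0) frob_eq0 orbb => /eqP.
have frob00 : frob F (0 : E) = 0 := frob0 F E.
have [|/eqP] := flm (frob F (l 0 o2)) (- l 0 o2).
  apply/rowP; elim/forall_ord3; rewrite !mxE ?l0 ?l1 ?frob00; ring.
rewrite frob_eq0 => /eqP l2 _.
have [|/eqP] := flm 1 0; last by rewrite oner_eq0.
by apply/rowP; elim/forall_ord3; rewrite !mxE ?l0 ?l1 ?l2 mulr0 mul0r addr0.
Qed.

Lemma net1_inj b c d b' c' d' :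
  hyperplane (net 1 b c d) = hyperplane (net 1 b' c' d') ->
  [/\ b = b', c = c' & d = d'].
Proof.
move=> eqh.
have := hyperplane_cross (i := o0) (j := o0) (k := o0) (n := o2) isT isT eqh.
have := hyperplane_cross (i := o0) (j := o0) (k := o1) (n := o2) isT isT eqh.
have := hyperplane_cross (i := o0) (j := o0) (k := o2) (n := o2) isT isT eqh.
by rewrite !mxE /= !mul1r !mulr1.
Qed.

Lemma num_imag_line_pair :
  #|hyperplanes_on (imag_line_pair iota)| = (#|F| ^ 2)%N.
Proof.
pose f (z : F * F) := hyperplane (net 1 z.1 z.2 (net_apex z)).
have inj_f : injective f by move=> [b c] [b' c'] /net1_inj[/= -> ->].
have -> : hyperplanes_on (imag_line_pair iota) = f @: setT.
  apply/setP=> H; apply/(hyperplanes_onP _ (@imag_line_pair_scale F E iota))/imsetP.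
    case=> _ [b [c [d [[]->]]]]; first by rewrite (negPf (imag_net0 _ _ _)).
    by rewrite imag_net1 => /eqP -> ->; exists (b, c).
  case=> z _ ->; exists 1, z.1, z.2, (net_apex z); split=> //; first by right.
  by rewrite imag_net1 -surjective_pairing.
by rewrite card_imset // cardsT card_prod mulnn.
Qed.

(** Conics with al = 0 are singular; among the q^3 triples (b, c, d) with al = 1, the singular ones
    form the graph [S] of [net_apex]. *)
Lemma num_nonsingular_conic :
  #|hyperplanes_on (@nonsingular_conic F)| = (#|F| ^ 3 - #|F| ^ 2)%N.
Proof.
pose f (z : F * F * F) := hyperplane (net 1 z.1.1 z.1.2 z.2).
have inj_f : injective f by move=> [[b c] d] [[b' c'] d'] /net1_inj[/= -> -> ->].
pose S := [set (z, net_apex z) | z : F * F].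
have -> : hyperplanes_on (@nonsingular_conic F) = f @: ~: S.
  apply/setP=> H; apply/(hyperplanes_onP _ (@nonsingular_conic_scale F))/imsetP.
    case=> _ [b [c [d [[]->]]]]; rewrite nonsingular_conicE.
      by rewrite disc_net mul0r eqxx.
    rewrite disc_net1_eq0 => nd ->; exists ((b, c), d) => //.
    by rewrite in_setC; apply: contra nd => /imsetP[z _ [-> ->]].
  case=> -[[b c] d]; rewrite in_setC => nS ->.
  exists 1, b, c, d; split=> //; first by right.
  rewrite nonsingular_conicE disc_net1_eq0.
  by apply: contra nS => /eqP->; apply: imset_f.
rewrite card_imset // cardsCs setCK !card_prod card_imset => [|x y []] //.
by rewrite card_prod mulnn -expnSr.
Qed.

End Counting.

End Net.

(** * Transport of the four counts to every line of the orbit *)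

Theorem lemma4p8 (q : nat) (F E : finFieldType) (iota : {rmorphism F -> E})
    (cardF : #|F| = q) (cardE : #|E| = (q ^ 2)%N)
    (L : {set {set 'M[F]_3}}) (L_line : L \in pg_lines F) (L_o10 : L \in o10 F) :
  OD4 iota L = [:: 1; q ^ 2 + q; q ^ 2; q ^ 3 - q ^ 2]%N.
Proof.
subst q; move: L_o10; rewrite inE => /existsP[u /existsP[v0 /andP[uv orbL]]].
rewrite /OD4 (num_hyperplanes_K_orbit (@double_line_subst F) orbL).
rewrite (num_hyperplanes_K_orbit (@real_line_pair_subst F) orbL).
rewrite (num_hyperplanes_K_orbit (@imag_line_pair_subst F E iota) orbL).
rewrite (num_hyperplanes_K_orbit (@nonsingular_conic_subst F) orbL).
congr [:: _; _; _; _].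
- exact: num_double_line.
- exact: num_real_line_pair.
- exact: num_imag_line_pair.
- exact: (num_nonsingular_conic uv iota cardE).
Qed.
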